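(* Let $(X,Y)$ be a pair of real random variables with joint density $h=\exp(-\varphi)$ with respect to Lebesgue measure on $\mathbb{R}^2$, and let $\Psi:\mathbb{R}^2\to\mathbb{R}$ be nondecreasing in each argument. Let $S_X(x,s)=\mathbb{P}[X>x\mid X+Y=s]$ and $S_Y(y,s)=\mathbb{P}[Y>y\mid X+Y=s]$. Assume that Efron's monotonicity property holds, i.e. the following equivalent statements hold: (i) for any $\Phi:\mathbb{R}^2\to\mathbb{R}$ nondecreasing in each argument, $s\mapsto\mathbb{E}[\Phi(X,Y)\mid X+Y=s]$ is nondecreasing; (ii) for any $(x,y)\in\mathbb{R}^2$, $S_X(x,s)$ and $S_Y(y,s)$ are nondecreasing in $s$. Let $s_0\in\mathbb{R}$, $\varepsilon>0$ and $V(s_0)=[s_0-\varepsilon,s_0+\varepsilon]$. Assume that $h=\exp(-\varphi)$ is positive and coordinatewise differentiable on $\mathbb{R}^2$, and that $\Psi$ is coordinatewise differentiable on $\mathbb{R}^2$. Assume that for any $s\in V(s_0)$ the functions $x\mapsto\Psi(x,s-x)$ and $x\mapsto(\partial_1\varphi)(x,s-x)$ are absolutely continuous, and that for all $(x,y)\in\mathbb{R}^2$ the functions $S_X(x,s)$ and $S_Y(y,s)$ are nondecreasing in $s\in V(s_0)$. If there exist four functions $A,B,C,D\in L_1(\mathrm{Leb})$ on $\mathbb{R}$ and a positive constant $M$ such that, for all $(s,x,y)\in V(s_0)\times\mathbb{R}^2$, $$|\Psi(s-y,y)|\le M,$$ $$|\partial_1\Psi(s-y,y)\,h(s-y,y)|\le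 A(y),$$ $$|\partial_1\varphi(s-y,y)\,h(s-y,y)|\le B(y),$$ $$|\partial_2\varphi(x,s-x)\exp(-\varphi(x,s-x))|\le C(x)\wedge D(s-x),$$ then the function $I(s)=\mathbb{E}[\Psi(X,Y)\mid X+Y=s]$ is differentiable at the point $s_0$ and $$I'(s_0)\ \ge\ \left(1-\sup_{x\in\mathbb{R}}\left\{\frac{\partial_2S_Y(s_0-x,s_0)}{\partial_2S_X(x,s_0)+\partial_2S_Y(s_0-x,s_0)}\right\}\right)\mathbb{E}\left[(\partial_1\Psi)(X,Y)\mid X+Y=s_0\right].$$
   Context: Notation. $\varphi=-\log h$; $\partial_1,\partial_2$ denote partial derivatives with respect to the first and second argument; in particular $\partial_2S_X$, $\partial_2S_Y$ are derivatives with respect to $s$. The conditional law of $X$ given $X+Y=s$ is the probability measure on $\mathbb{R}$ with density $f_1(x;s)=h(x,s-x)/\int_{\mathbb{R}}h(x',s-x')dx'$, and that of $Y$ given $X+Y=s$ has density $f_2(y;s)=h(s-y,y)/\int_{\mathbb{R}}h(s-y',y')dy'$; thus $I(s)=\int_{\mathbb{R}}\Psi(s-y,y)f_2(y;s)\,dy=\int_{\mathbb{R}}\Psi(x,s-x)f_1(x;s)\,dx$. The symbol $\wedge$ denotes minimum. *)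

(* Defs.v *)
From HB Require Import structures.
From mathcomp Require Import all_boot all_order all_algebra.
From mathcomp Require Import all_classical all_reals all_analysis.

Set Implicit Arguments.
Unset Strict Implicit.
Unset Printing Implicit Defensive.

Import Order.TTheory GRing.Theory Num.Theory.
Import numFieldNormedType.Exports.

Local Open Scope classical_set_scope.
Local Open Scope ring_scope.

Section TwoVariables.
Context {R : realType}.
Implicit Types F : R -> R -> R.

Definition partial1 F (x y : R) : R := derive1 (F^~ y) x.

Definition partial2 F (x y : R) : R := derive1 (F x) y.

Definition coordinatewise_differentiable F : Prop :=
  forall x y : R, derivable (F^~ y) x 1 /\ derivable (F x) y 1.

Definition coordinatewise_nondecreasing F : Prop :=
  (forall y : R, {homo F^~ y : a b / a <= b}) /\
  (forall x : R, {homo F x : a b / a <= b}).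

End TwoVariables.

Section AbsoluteContinuity.
Context {R : realType}.

(* The finitely many intervals [l i, r i] may share endpoints. *)
Definition absolutely_continuous_on (a b : R) (f : R -> R) : Prop :=
  forall e : R, 0 < e -> exists2 d : R, 0 < d &
    forall (n : nat) (l r : 'I_n -> R),
      (forall i, a <= l i /\ l i <= r i /\ r i <= b) ->
      (forall i j, i != j -> r i <= l j \/ r j <= l i) ->
      \sum_(i < n) (r i - l i) < d ->
      \sum_(i < n) `|f (r i) - f (l i)| < e.

(* On the whole line, absolute continuity is required on compact intervals. *)
Definition absolutely_continuous (f : R -> R) : Prop :=
  forall a b : R, a <= b -> absolutely_continuous_on a b f.

End AbsoluteContinuity.

Section ConditionalLaw.
Context {R : realType}.
Local Notation leb := (@lebesgue_measure R).
Implicit Types h Phi : R -> R -> R.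

Definition has_joint_density {d : measure_display} {T : measurableType d}
    (P : probability T R) (X Y : {RV P >-> R}) h : Prop :=
  [/\ measurable_fun [set: measurableTypeR R * measurableTypeR R]
        (fun z => h z.1 z.2),
      (forall x y, 0 <= h x y) &
      forall A : set (measurableTypeR R * measurableTypeR R), measurable A ->
        P ((fun w => (X w, Y w)) @^-1` A) =
        (\int[(leb \x leb)%E]_(z in A) (h z.1 z.2)%:E)%E].

Definition phi h (x y : R) : R := - ln (h x y).

(* Density at [x] (resp. [y]) of the law of X (resp. Y) given X + Y = s. *)
Definition f1 h (x s : R) : R := h x (s - x) / \int[leb]_u h u (s - u).

Definition f2 h (y s : R) : R := h (s - y) y / \int[leb]_v h (s - v) v.

(* These densities are meaningful when the density of X + Y at s is positive
   and finite. A joint density only ensures finiteness for almost every s; the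
   real-valued integral is 0 when the integrand is not integrable. *)
Definition cond_law_defined h (s : R) : Prop :=
  leb.-integrable setT (fun x => (h x (s - x))%:E) /\
  0 < \int[leb]_x h x (s - x).

Definition S_X h (x s : R) : R := \int[leb]_(u in `]x, +oo[) f1 h u s.

Definition S_Y h (y s : R) : R := \int[leb]_(v in `]y, +oo[) f2 h v s.

(* E[Phi(X,Y) | X + Y = s] *)
Definition cond_expectation h Phi (s : R) : R :=
  \int[leb]_y (Phi (s - y) y * f2 h y s).

Definition cond_integrable h Phi (s : R) : Prop :=
  leb.-integrable setT (fun y => (Phi (s - y) y * f2 h y s)%:E).

Definition efron_expectation h : Prop :=
  forall Phi, coordinatewise_nondecreasing Phi ->
  forall s t : R, s <= t ->
    cond_law_defined h s -> cond_law_defined h t ->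
    cond_integrable h Phi s -> cond_integrable h Phi t ->
    cond_expectation h Phi s <= cond_expectation h Phi t.

Definition efron_survival h : Prop :=
  forall x y s t : R, s <= t ->
    cond_law_defined h s -> cond_law_defined h t ->
    S_X h x s <= S_X h x t /\ S_Y h y s <= S_Y h y t.

Definition efron_monotonicity h : Prop :=
  efron_expectation h /\ efron_survival h.

End ConditionalLaw.

(* Main.v *)
Require Import Defs.
From HB Require Import structures.
From mathcomp Require Import all_boot all_order all_algebra.
From mathcomp Require Import all_classical all_reals all_analysis.
From mathcomp Require Import measurable_realfun ring lra.

Set Implicit Arguments.
Unset Strict Implicit.
Unset Printing Implicit Defensive.

Import Order.TTheory GRing.Theory Num.Theory.
Import numFieldNormedType.Exports.

Local Open Scope classical_set_scope.
Local Open Scope ring_scope.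

(** At [s0] the dominations allow differentiation under the integral sign, so that
    [I'(s0)] is [E[d1 Psi]] plus the integral of [G(y) = Psi(s0 - y, y)] against the
    [s]-derivative of the conditional density of [Y]. The tail integral of the latter
    is [K(y) = d2 S_Y(y, s0) >= 0], and [dG >= - q dy] with [q(y) = d1 Psi(s0 - y, y)],
    so integration by parts bounds that integral below by [- int q K]. Finally
    [S_X(s0 - y, s) + S_Y(y, s)] is [1] plus the conditional probability that
    [Y] lies in the interval [(y, y + s - s0)], so [d2 S_X(s0 - y, s0) + K(y)] is the
    conditional density of [Y] at almost every [y]; hence [K] is at most the
    supremum times this density, which gives the bound. *)

(** * A Dini mean value inequality and integration by parts *)

Section Lebesgue.
Context {R : realType}.
Local Notation mu := (@lebesgue_measure R).

(** Coordinatewise differentiability gives no chain rule along the lines x + y = s. For [Psi] the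
    argument therefore works with continuity along the line and a one-sided bound on increments,
    hence with Dini derivatives; for [h] the density identity is obtained almost everywhere only,
    which suffices because it is used under an integral. Integrability has to be earned too. A joint
    density controls almost every line, and the bound [B] on the derivative in s carries
    integrability from one such line to all nearby ones. Likewise [q] is known to be integrable only
    against [h], so the comparison of [K] with the density is both the final estimate and the reason
    why [q K] is integrable at all. The supremum is a genuine one: monotonicity puts each ratio
    between 0 and 1, with 0 / 0 = 0. *)

Lemma integrable_cst_itvcc (a b k : R) :
  mu.-integrable `[a, b] (EFin \o cst k).
Proof.
apply: continuous_compact_integrable; first exact: segment_compact.
by apply: continuous_subspaceT => x; exact: cvg_cst.
Qed.

(* The upper function [U] below is the indefinite integral of a lower
   semicontinuous majorant of [r] (Vitali-Caratheodory): [(k+1) e] on an open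
   superset [V k] of the level set [E k = {k e <= r < (k+1) e}], chosen with a
   measure excess that is summable against the weights [(k+1) e]. Only the
   monotonicity of [U] is needed for the supremum argument. *)
Lemma dini_le_integral (a b : R) (Phi r : R -> R) : a <= b ->
  continuous Phi ->
  mu.-integrable `[a, b] (EFin \o r) ->
  (forall x, x \in `[a, b] -> 0 <= r x) ->
  (forall x, x \in `[a, b[ ->
    \forall t \near 0^'+, Phi (x + t) - Phi x <= r x * t) ->
  Phi b - Phi a <= \int[mu]_(x in `[a, b]) r x.
Proof.
move=> ab cPhi ir r0 dini.
have mr : measurable_fun `[a, b] r by apply/measurable_EFinP;
  exact: measurable_int ir.
have mab : measurable (`[a, b] : set (measurableTypeR R)) by exact: measurable_itv.
(* The [e] under the integral pays for rounding [r] up to the next level, the one outside for the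
   excess measure of the [V k]. Using [e / (b - a + 1)] instead of [e] makes the total loss equal to
   [e]. *)
suff key : forall e : R, 0 < e ->
    ((Phi b - Phi a)%:E <= \int[mu]_(x in `[a, b]) ((r x + e)%:E) + e%:E)%E.
  suff H (e : R) (e0 : 0 < e) : Phi b - Phi a <= \int[mu]_(x in `[a, b]) r x + e.
    by apply/ler_addgt0Pr => e e0; exact: H.
  have d0 : 0 < e / (b - a + 1) by rewrite divr_gt0 // ltr_wpDl ?subr_ge0.
  have : e / (b - a + 1) * (b - a + 1) = e.
    by rewrite divfK // gt_eqF // ltr_wpDl ?subr_ge0.
  move: (e / _ : R) d0 => d d0 de.
  have := key _ d0.
  have fin : (\int[mu]_(x in `[a, b]) ((r x + d)%:E) =
    (\int[mu]_(x in `[a, b]) r x + d * (b - a))%:E)%E.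
    rewrite integralD_EFin //; last exact: integrable_cst_itvcc.
    rewrite integral_cst //= lebesgue_measure_itv/= lte_fin.
    rewrite /Rintegral EFinD fineK ?integrable_fin_num //.
    congr (_ + _)%E; case: ltP => [_|ba]; first by rewrite -EFinB -EFinM.
    by rewrite mule0 (_ : b - a = 0) ?mulr0 //; lra.
  rewrite fin -EFinD lee_fin -addrA -[X in _ + (_ + X)]mulr1 -mulrDr de.
  exact.
move=> e e0.
pose E k := `[a, b] `&` r @^-1` `[k%:R * e, k.+1%:R * e[.
have mE k : measurable (E k : set (measurableTypeR R)).
  by apply: mr => //; exact: measurable_itv.
have muE k : (mu (E k) < +oo)%E.
  apply: (@le_lt_trans _ _ (mu `[a, b])); last first.
    by rewrite lebesgue_measure_itv/=; case: ifP => _; rewrite ?ltry.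
  by apply: le_measure; rewrite ?inE//; exact: subIsetl.
(* The weighted excess [(k+1) e * d k] is then [e / 2^(k+1)], with sum [e]. *)
pose d (k : nat) : R := (k.+1%:R)^-1 / (2 ^ k.+1)%:R.
have d0 k : 0 < d k by rewrite divr_gt0 // ?invr_gt0 // ltr0n // expn_gt0.
have /choice[V VE] := (fun k => lebesgue_regularity_outer (mE k) (muE k) (d0 k)).
have oO k : open (V k) by case: (VE k).
have mO k : measurable (V k : set (measurableTypeR R)) by exact: open_measurable.
pose U x : \bar R := (\sum_(k <oo) (k.+1%:R * e)%:E * mu (V k `&` `[a, x]))%E.
have c0 k : (0 <= (k.+1%:R * e)%:E)%E by rewrite lee_fin mulr_ge0 // ltW.
have mOx k x : measurable (V k `&` `[a, x] : set (measurableTypeR R)).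
  by apply: measurableI => //; exact: measurable_itv.
have U0 x k : (0 <= (k.+1%:R * e)%:E * mu (V k `&` `[a, x]))%E by exact: mule_ge0.
have Umono x y : x <= y -> (U x <= U y)%E.
  move=> xy; apply: lee_nneseries => // k _; apply: lee_wpmul2l => //.
  apply: le_measure; rewrite ?inE//; apply: setIS.
  by apply: subset_itvl; rewrite bnd_simp.
have UbE : (U b <= \int[mu]_(x in `[a, b]) ((r x + e)%:E) + e%:E)%E.
  have Eab : [set` `[a, b]] = \bigcup_k E k.
    apply/seteqP; split => [x xab|x [k _ []]] //.
    have rx := r0 x xab.
    exists (Num.truncn (r x / e)) => //; split => //=.
    have h0 : 0 <= r x / e by rewrite divr_ge0 // ltW.
    rewrite in_itv/= -ler_pdivlMr // -ltr_pdivrMr //.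
    by apply: truncn_itv.
  have -> : (\int[mu]_(x in `[a, b]) ((r x + e)%:E) =
      \sum_(k <oo) \int[mu]_(x in E k) ((r x + e)%:E))%E.
    rewrite -ge0_integral_bigcup -?Eab//.
    - by apply/measurable_EFinP/measurable_funD.
    - by move=> x xab; rewrite lee_fin addr_ge0 ?r0 // ltW.
    - apply/trivIsetP => i j _ _ ij; rewrite -subset0 => x [[_ /= xi] [_ /= xj]].
      move: xi xj; rewrite !in_itv/= -!ler_pdivlMr // -!ltr_pdivrMr //.
      move=> /andP[i1 i2] /andP[j1 j2]; move: ij; apply/negP; rewrite negbK.
      have := le_lt_trans i1 j2; have := le_lt_trans j1 i2.
      by rewrite !ltr_nat !ltnS eqn_leq => -> ->.
  apply: le_trans; last first.
    apply: (epsilon_trick xpredT _ (ltW e0)) => k.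
    by apply: integral_ge0 => x [xab _]; rewrite lee_fin addr_ge0 ?r0 // ltW.
  apply: lee_nneseries => // k _.
  case: (VE k) => _ EO mOE.
  apply: (@le_trans _ _ ((k.+1%:R * e)%:E * (mu (E k) + (d k)%:E))%E).
    apply: lee_wpmul2l => //.
    apply: (@le_trans _ _ (mu (V k))).
      by apply: le_measure; rewrite ?inE//; exact: subIsetl.
    rewrite -(setDUK EO) measureU ?setDIK//; last exact: measurableD.
    by apply: leeD => //; exact: ltW.
  rewrite ge0_muleDr // ?lee_fin ?(ltW (d0 _)) //; apply: leeD.
    rewrite -integral_cst //; apply: ge0_le_integral => //.
    - by move=> x _; exact: c0.
    - by apply/measurable_EFinP/measurable_funD => //;
      apply: measurable_funS mr => //; exact: subIsetl.
    - move=> x [xab /=]; rewrite in_itv/= => /andP[kr _].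
      by rewrite lee_fin -natr1 mulrDl mul1r lerD2r.
  rewrite -EFinM lee_fin /d mulrACA mulrCA mulfV ?pnatr_eq0 // mul1r; exact: lexx.
apply: le_trans UbE.
(* Supremum argument: [S] contains its supremum because [Phi] is continuous and [U] nondecreasing,
   and a supremum below [b] could be pushed to the right. *)
pose S := [set x | x \in `[a, b] /\ ((Phi x - Phi a)%:E <= U x)%E].
have Sa : S a by split; rewrite ?in_itv/= ?lexx//= subrr; apply: nneseries_ge0.
have ubS : ubound S b by move=> x [/itvP ->].
have hS : has_sup S by split; [exists a|exists b].
set c := sup S.
have cb : c <= b by apply: ge_sup => //; exists a.
have ac : a <= c by apply: ub_le_sup => //; exists b.
have Sc : S c.
  split; first by rewrite in_itv/= ac cb.
  apply/lee_addgt0Pr => h h0.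
  have /cvgrPdist_lt/(_ _ h0)[z /= z0 zP] := cPhi c.
  have [x Sx cx] := sup_adherent z0 hS.
  have xc : x <= c by apply: ub_le_sup => //; exists b.
  have := zP x; rewrite /= ger0_norm ?subr_ge0 // => /(_ _)/ltr_normlW.
  rewrite ltrBlDr => H.
  apply: (@le_trans _ _ ((Phi x - Phi a)%:E + h%:E)%E).
    rewrite -EFinD lee_fin.
    have := H _. rewrite ltrBlDr -ltrBlDl => /(_ cx). lra.
  apply: leeD => //; case: Sx => _ /le_trans; apply; exact: Umono.
suff -> : b = c by case: Sc.
apply/eqP; rewrite eq_le cb andbT leNgt; apply/negP => cltb.
have rc := r0 c (Sc.1).
pose k := Num.truncn (r c / e).
have Ekc : E k c.
  split; first exact: Sc.1.
  have h0 : 0 <= r c / e by rewrite divr_ge0 // ltW.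
  rewrite /= in_itv/= -ler_pdivlMr // -ltr_pdivrMr //.
  by apply: truncn_itv.
(* [V k] is open around [c], so just to the right of [c] the function [U] grows with slope at least
   [(k+1) e], which exceeds [r c] and outruns the Dini bound on [Phi]. *)
have Okc : V k c by case: (VE k) => _ + _; apply.
have [z /= z0 zO] := (oO k c Okc).
have cab : c \in `[a, b[ by rewrite in_itv/= ac.
have [t [t0 tz tb tP]] :
  exists t : R, [/\ 0 < t, t < z, c + t <= b & Phi (c + t) - Phi c <= r c * t].
  near (0%R:R)^'+ => t; exists t; split.
  - by [].
  - by near: t; exact: nbhs_right_lt.
  - rewrite -lerBrDl; near: t; apply: nbhs_right_le; lra.
  - by near: t; exact: dini.
suff Sct : S (c + t).
  have : c + t <= c by apply: ub_le_sup => //; exists b.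
  by rewrite gerDl leNgt t0.
split; first by rewrite in_itv/= tb (le_trans ac)// lerDl ltW.
apply: (@le_trans _ _ (U c + (r c * t)%:E)%E).
  apply: (@le_trans _ _ ((Phi c - Phi a)%:E + (r c * t)%:E)%E).
    by rewrite -EFinD lee_fin; lra.
  by apply: leeD => //; case: Sc.
have sub : `]c, c + t] `<=` V k `&` `[a, c + t].
  move=> x /=; rewrite in_itv/= => /andP[cx xct]; split; last first.
    by rewrite /= in_itv/= xct (le_trans ac)// ltW.
  by apply: zO => /=; rewrite ltr0_norm ?subr_lt0 //; lra.
(* The gain is charged to the [k]-th term of the series alone; the other terms can only grow. *)
apply: (@le_trans _ _
  (U c + \sum_(i <oo) (if i == k then (k.+1%:R * e * t)%:E else 0))%E).
  apply: leeD => //.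
  have f0 i : (0 <= if i == k then (k.+1%:R * e * t)%:E else 0)%E.
    by case: ifP => // _; rewrite lee_fin !mulr_ge0 // ltW.
  apply: le_trans (nneseries_lim_ge k.+1 _) => //.
  rewrite big_nat_recr//= eqxx; apply: (@le_trans _ _ (k.+1%:R * e * t)%:E).
    rewrite lee_fin ler_wpM2r ?(ltW t0)// ltW //.
    by case: Ekc => _ /=; rewrite in_itv/= => /andP[].
  by apply: leeDr; apply: sume_ge0.
rewrite -nneseriesD //; last first.
  by move=> i _ _; case: ifP => // _; rewrite lee_fin !mulr_ge0 // ltW.
apply: lee_nneseries.
  by move=> i _ _; apply: adde_ge0 => //; case: ifP => // _;
    rewrite lee_fin !mulr_ge0 // ltW.
move=> i _; case: eqP => [->|_]; last first.
  rewrite adde0; apply: lee_wpmul2l => //; apply: le_measure; rewrite ?inE//.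
  by apply: setIS; apply: subset_itvl; rewrite bnd_simp lerDl ltW.
rewrite [X in (_ + X)%E]EFinM -ge0_muleDr // ?lee_fin ?(ltW t0)//;
  apply: lee_wpmul2l => //.
have -> : t%:E = mu `]c, c + t].
  by rewrite lebesgue_measure_itv/= lte_fin ltrDl t0 -EFinD addrAC subrr add0r.
rewrite -measureU //; first 1 last.
- by rewrite -subset0 => x [[_] /=]; rewrite !in_itv/= => /andP[_ xc] /andP[];
  rewrite ltNge xc.
apply: le_measure; rewrite ?inE//; first exact: measurableU.
rewrite subUset; split => //.
by apply: setIS; apply: subset_itvl; rewrite bnd_simp lerDl ltW.
Unshelve. all: by end_near.
Qed.

(** * Integrals over half-lines and integration by parts *)

Implicit Types (f g w q G : R -> R) (x y z : R).

Lemma integrable_setTS f (A : set (measurableTypeR R)) : measurable A ->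
  mu.-integrable setT (EFin \o f) -> mu.-integrable A (EFin \o f).
Proof. by move=> mA; apply: integrableS. Qed.

Lemma Rintegral_lower_diff f y z : mu.-integrable setT (EFin \o f) -> y <= z ->
  \int[mu]_(x in `]-oo, z]) f x - \int[mu]_(x in `]-oo, y]) f x =
  \int[mu]_(x in `]y, z]) f x.
Proof.
move=> fi yz; apply: Rintegral_itvB; rewrite ?bnd_simp//.
by apply: integrable_setTS => //; exact: measurable_itv.
Qed.

Lemma Rintegral_lower_upper f y : mu.-integrable setT (EFin \o f) ->
  \int[mu]_(x in `]y, +oo[) f x =
  \int[mu]_x f x - \int[mu]_(x in `]-oo, y]) f x.
Proof.
move=> fi; rewrite -(@Rintegral_itvB _ f -oo%O +oo%O y) ?bnd_simp ?set_itvE//.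
Qed.

(** Absolute continuity of the integral: [|f|] has small integral over sets of small measure. *)
Lemma continuous_Rintegral_lower f : mu.-integrable setT (EFin \o f) ->
  continuous (fun y => \int[mu]_(x in `]-oo, y]) f x).
Proof.
move=> fi y; apply/cvgrPdist_lt => e e0.
have [d [d0 dP]] := integral_normr_continuous fi e0.
have main (u v : R) : u <= v -> v - u < d ->
    `|\int[mu]_(x in `]-oo, v]) f x - \int[mu]_(x in `]-oo, u]) f x| < e.
  move=> uv uvd; rewrite Rintegral_lower_diff//.
  apply: le_lt_trans (le_normr_Rintegral _ _) _ => //.
    by apply: integrable_setTS => //; exact: measurable_itv.
  apply: dP; first exact: measurable_itv.
  by rewrite /= lebesgue_measure_itv/=; case: ifP => _; rewrite lte_fin.
near=> z.
have : `|y - z| < d by near: z; exact: (@cvgr_dist_lt _ _ _ _ _ id).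
rewrite ltr_norml => /andP[yz zy].
have [yz'|zy'] := leP y z.
  rewrite distrC; apply: main => //; lra.
by apply: main; [exact: ltW|].
Unshelve. all: by end_near.
Qed.

(** Dominated convergence with majorant [|f|]: at each point the restricted integrand is eventually
    zero. *)
Lemma Rintegral_vanishing_sets f (A : nat -> set (measurableTypeR R)) :
  mu.-integrable setT (EFin \o f) -> (forall n, measurable (A n)) ->
  (forall x, \forall n \near \oo, ~ A n x) ->
  \int[mu]_(x in A n) f x @[n --> \oo] --> 0.
Proof.
move=> fi mA Ax; rewrite /Rintegral; apply: fine_cvg.
suff : (\int[mu]_x (((EFin \o f) \_ (A n)) x) @[n --> \oo] -->
    \int[mu]_x (cst 0 x))%E.
  by rewrite integral0; under eq_fun do rewrite -integral_mkcond.
have mf : measurable_fun setT (EFin \o f) by exact: measurable_int fi.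
apply: (@dominated_cvg _ _ _ mu _ measurableT _ _ (abse \o (EFin \o f))) => //.
- by move=> n; apply/(measurable_restrictT _ _).1 => //; exact: measurable_funS mf.
- move=> x _; apply: cvg_near_cst; near=> n.
  by rewrite patchE memNset //; near: n; exact: Ax.
- exact: integrable_abse.
- by move=> n x _; rewrite patchE; case: ifP => _ /=;
  rewrite ?lexx // normr0 lee_fin.
Unshelve. all: by end_near.
Qed.

Lemma Rintegral_upper_cvg0 f : mu.-integrable setT (EFin \o f) ->
  \int[mu]_(x in `]n%:R, +oo[) f x @[n --> \oo] --> 0.
Proof.
move=> fi; apply: Rintegral_vanishing_sets => // x.
near=> n; rewrite /= in_itv/= andbT; apply/negP; rewrite -leNgt ltW//.
by near: n; exact: nbhs_infty_gtr.
Unshelve. all: by end_near.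
Qed.

Lemma Rintegral_lower_cvg0 f : mu.-integrable setT (EFin \o f) ->
  \int[mu]_(x in `]-oo, (- n%:R)]) f x @[n --> \oo] --> 0.
Proof.
move=> fi; apply: Rintegral_vanishing_sets => // x.
near=> n; rewrite /= in_itv/=; apply/negP; rewrite -ltNge ltrNl.
by near: n; exact: nbhs_infty_gtr.
Unshelve. all: by end_near.
Qed.


Lemma integrable_bounded_mul (G w : R -> R) (M : R) :
  measurable_fun setT G -> (forall y, `|G y| <= M) ->
  mu.-integrable setT (EFin \o w) ->
  mu.-integrable setT (EFin \o (fun y => G y * w y)).
Proof.
move=> mG GM iw; have bG : [bounded G x | x in setT].
  by exists M; split; rewrite ?num_real// => x Mx y _;
    exact: le_trans (GM y) (ltW Mx).
exact: (@integrableMr _ _ _ mu _ measurableT G (EFin \o w) mG bG iw).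
Qed.

Lemma Rintegral_sub_le f (A : set (measurableTypeR R)) : measurable A ->
  mu.-integrable setT (EFin \o f) -> (forall x, 0 <= f x) ->
  \int[mu]_(x in A) f x <= \int[mu]_x f x.
Proof.
move=> mA fi f0; apply: fine_le.
- by apply: integrable_fin_num => //; exact: integrable_setTS.
- exact: integrable_fin_num.
- apply: ge0_subset_integral => //; last by move=> x _; rewrite lee_fin.
  exact: measurable_int fi.
Qed.

(** The bound is uniform over [[y, y + t]] because it serves to replace [G] by [G y] under an
    integral over that interval. *)
Lemma near_right_continuous f y (d : R) : continuous f -> 0 < d ->
  \forall t \near 0^'+, forall v, y <= v <= y + t -> `|f v - f y| <= d.
Proof.
move=> cf d0.
have /cvgrPdist_le/(_ _ d0)[r /= r0 rP] := cf y.
near=> t => v /andP[yv vyt]; rewrite distrC; apply: rP => /=.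
rewrite ler0_norm ?subr_le0// opprB; apply: (@le_lt_trans _ _ t); first lra.
by near: t; exact: nbhs_right_lt.
Unshelve. all: by end_near.
Qed.

(* Formally [W dG >= - q W dx] and [dW = - w dx]. Nothing is assumed on [q]
   alone: it need not be locally integrable where [W] vanishes, so [G] cannot be
   compared with an indefinite integral of [q]; instead [dini_le_integral] is
   applied to [- W G - int G w], whose upper right Dini derivative is at most
   [q W] up to an error absorbed by the term [e * N]. *)
Lemma Rintegral_by_parts_ge (G w q : R -> R) (M : R) :
  continuous G -> (forall y, `|G y| <= M) ->
  mu.-integrable setT (EFin \o w) -> \int[mu]_x w x = 0 ->
  let W y := \int[mu]_(x in `]y, +oo[) w x in
  (forall y, 0 <= W y) -> (forall y, 0 <= q y) ->
  mu.-integrable setT (EFin \o (fun y => q y * W y)) ->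
  (forall y (e : R), 0 < e ->
    \forall t \near 0^'+, - ((q y + e) * t) <= G (y + t) - G y) ->
  - (\int[mu]_y (q y * W y)) <= \int[mu]_y (G y * w y).
Proof.
move=> cG GM iw w0 W W0 q0 iqW dini.
have mG : measurable_fun setT G by exact: continuous_measurable_fun.
have iGw : mu.-integrable setT (EFin \o (fun y => G y * w y)).
  exact: integrable_bounded_mul.
have iaw : mu.-integrable setT (EFin \o (fun y => `|w y|)).
  exact: integrable_norm.
pose w1 := \int[mu]_x `|w x|.
pose F y := \int[mu]_(x in `]-oo, y]) w x.
pose H y := \int[mu]_(x in `]-oo, y]) (G x * w x).
pose N y := \int[mu]_(x in `]-oo, y]) `|w x|.
(* Zero total mass turns the upper tail into minus the lower integral; in particular [W] also
   vanishes at -oo. *)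
have WF y : W y = - F y by rewrite /W Rintegral_lower_upper// w0 sub0r.
have WE : W = \- F by apply/funext => y; exact: WF.
have cF : continuous F by exact: continuous_Rintegral_lower.
have cW : continuous W by rewrite WE => y; apply: continuousN; exact: cF.
have Ww1 y : W y <= w1.
  apply: le_trans (ler_norm _) (le_trans (le_normr_Rintegral _ _) _) => //.
    by apply: integrable_setTS => //; exact: measurable_itv.
  by apply: Rintegral_sub_le => //; exact: measurable_itv.
have N01 y : 0 <= N y <= w1.
  apply/andP; split; first by apply: Rintegral_ge0.
  by apply: Rintegral_sub_le => //; exact: measurable_itv.
have w10 : 0 <= w1 by case/andP: (N01 0) => /le_trans; apply.
pose Phi (e y : R) : R := - (W y * G y) - H y - e * N y.
have cPhi e : continuous (Phi e).
  move=> y; rewrite /Phi; apply: cvgB; last apply: cvgMr.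
    apply: cvgB; last exact: continuous_Rintegral_lower.
    by apply: cvgN; apply: cvgM; [exact: cW|exact: cG].
  exact: continuous_Rintegral_lower.
have step (e : R) (e0 : 0 < e) y : \forall t \near 0^'+,
    Phi e (y + t) - Phi e y <= (q y * W y + e * (1 + w1)) * t.
  (* This scale makes [q y] times the oscillation of [W] at most [e], however large [q y] is. *)
  have eq0 : 0 < e / (q y + 1) by rewrite divr_gt0// ltr_wpDl.
  near=> t.
  have t0 : 0 < t by [].
  have yt : y <= y + t by rewrite lerDl ltW.
  have Wv v : y <= v <= y + t -> `|W v - W y| <= e / (q y + 1).
    by move: v; near: t; exact: near_right_continuous.
  have Wt : `|W (y + t) - W y| <= e / (q y + 1) by apply: Wv; rewrite yt lexx.
  have Gt v : y <= v <= y + t -> `|G v - G y| <= e.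
    by move: v; near: t; exact: near_right_continuous.
  have dG : - ((q y + e) * t) <= G (y + t) - G y by near: t; exact: dini.
  have miv : measurable (`]y, y + t] : set (measurableTypeR R))
    by exact: measurable_itv.
  have dF : F (y + t) - F y = \int[mu]_(x in `]y, y + t]) w x.
    exact: Rintegral_lower_diff.
  have dN : N (y + t) - N y = \int[mu]_(x in `]y, y + t]) `|w x|.
    exact: Rintegral_lower_diff.
  have dH : H (y + t) - H y = \int[mu]_(x in `]y, y + t]) (G x * w x).
    exact: Rintegral_lower_diff.
  have HGF : G y * (F (y + t) - F y) - (H (y + t) - H y) <= e * (N (y + t) - N y).
    have icf (c : R) f : mu.-integrable setT (EFin \o f) ->
        mu.-integrable setT (EFin \o (fun x => c * f x)).
      by move=> fi; apply: (@integrable_bounded_mul (cst c) _ `|c|) => //;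
        exact: measurable_cst.
    rewrite dF dN dH -!RintegralZl//; [|exact: integrable_setTS..].
    rewrite -RintegralB//; [|exact/integrable_setTS/icf|exact: integrable_setTS].
    apply: le_Rintegral => //.
    - apply: integrable_setTS => //.
      exact: (integrableB measurableT (icf (G y) _ iw) iGw).
    - exact/integrable_setTS/icf.
    - move=> x; rewrite /= in_itv/= => /andP[yx xyt].
      rewrite -mulrBl; apply: le_trans (ler_norm _) _; rewrite normrM distrC.
      by rewrite ler_wpM2r// Gt// xyt ltW.
  have Wdiff : q y * (W (y + t) - W y) <= e.
    apply: (@le_trans _ _ (q y * (e / (q y + 1)))).
      by rewrite ler_wpM2l// (le_trans (ler_norm _)).
    by rewrite mulrCA ler_piMr ?(ltW e0)// ler_pdivrMr ?ltr_wpDl// mul1r lerDl.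
  rewrite /Phi.
  (* Discrete product rule. The middle term is the error of replacing [G] by [G y] under the
     integral, and the increment of [e * N] compensates it. *)
  have E1 : - (W (y + t) * G (y + t)) - H (y + t) - e * N (y + t) -
    (- (W y * G y) - H y - e * N y) =
    - W (y + t) * (G (y + t) - G y) + (G y * (F (y + t) - F y) - (H (y + t) - H y))
    - e * (N (y + t) - N y) by rewrite !WF; ring.
  rewrite E1.
  have E2 : - W (y + t) * (G (y + t) - G y) <= W (y + t) * ((q y + e) * t).
    by rewrite mulNr lerNl -mulrN ler_wpM2l.
  have E3 : W (y + t) * (q y + e) <= q y * W y + e * (1 + w1).
    have := ler_wpM2l (ltW e0) (Ww1 (y + t)). nra.
  have := ler_wpM2r (ltW t0) E3.
  lra.
have bound (e : R) (e0 : 0 < e) n : Phi e n%:R - Phi e (- n%:R) <=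
    \int[mu]_y (q y * W y) + e * (1 + w1) * (n%:R *+ 2).
  have qe0 y : 0 <= q y * W y + e * (1 + w1).
    by rewrite addr_ge0 ?mulr_ge0 ?(ltW e0) ?addr_ge0.
  have nn : - (n%:R) <= n%:R :> R by rewrite (@le_trans _ _ 0)// oppr_le0.
  have miv : measurable (`[- n%:R, n%:R] : set (measurableTypeR R))
    by exact: measurable_itv.
  have mnn : fine (mu `[- n%:R, n%:R]) = n%:R *+ 2.
    rewrite lebesgue_measure_itv/= lte_fin; case: ltP => [_|nn'] /=.
      by rewrite opprK mulr2n.
    by rewrite (@le_anti _ _ n%:R 0) ?mul0rn// ler0n andbT; lra.
  apply: (@le_trans _ _
    (\int[mu]_(y in `[- n%:R, n%:R]) (q y * W y + e * (1 + w1)))).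
    apply: dini_le_integral => //.
      exact: (integrableD miv (integrable_setTS miv iqW)
        (integrable_cst_itvcc _ _ (e * (1 + w1)))).
    by move=> y _; exact: step.
  rewrite RintegralD//; last 2 first.
  - exact: integrable_setTS.
  - exact: integrable_cst_itvcc.
  rewrite Rintegral_cst// mnn lerD2r.
  by apply: Rintegral_sub_le => // y; rewrite mulr_ge0.
have bound0 n : Phi 0 n%:R - Phi 0 (- n%:R) <= \int[mu]_y (q y * W y).
  suff key (d : R) : 0 < d -> Phi 0 n%:R - Phi 0 (- n%:R) <=
    \int[mu]_y (q y * W y) + d.
    by apply/ler_addgt0Pr => d d0; exact: key.
  move=> d0.
  (* With [e = d / c] the loss on [[-n, n]] and the one from [e * N] add up to at most [d]; the
     final 1 keeps [c] positive when [n] and [w1] vanish. *)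
  pose c : R := (1 + w1) * (n%:R *+ 2) + w1 + 1.
  have c0 : 0 < c.
    by rewrite /c ltr_wpDl// addr_ge0// mulr_ge0// ?addr_ge0// mulrn_wge0.
  pose e : R := d / c; have e0 : 0 < e by exact: divr_gt0.
  have ec : e * (1 + w1) * (n%:R *+ 2) + e * w1 + e = d.
    by rewrite -[RHS](divfK (lt0r_neq0 c0)) -/e /c; ring.
  have -> : Phi 0 n%:R - Phi 0 (- n%:R) =
    (Phi e n%:R - Phi e (- n%:R)) + e * (N n%:R - N (- n%:R)) by rewrite /Phi; ring.
  have eN : e * (N n%:R - N (- n%:R)) <= e * w1.
    rewrite ler_wpM2l ?(ltW e0)//.
    by have /andP[_ ?] := N01 n%:R; have /andP[? _] := N01 (- n%:R);
      rewrite lerBlDr ler_wpDr.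
  apply: (le_trans (lerD (bound e e0 n) eN)).
  by rewrite -ec -[leLHS]addrA lerD2l lerDl ltW.
(* The boundary terms disappear: [G] is bounded and [W] tends to 0 at both ends. *)
have lim : Phi 0 n%:R - Phi 0 (- n%:R) @[n --> \oo] --> - \int[mu]_y (G y * w y).
  have WG0 (u : R ^nat) : W (u n) @[n --> \oo] --> 0 ->
      W (u n) * G (u n) @[n --> \oo] --> 0.
    move=> Wu; apply: norm_cvg0;
      apply: (@squeeze_cvgr _ _ _ _ (cst 0) (fun n => W (u n) * M)).
    - by apply: nearW => n; rewrite normr_ge0 normrM (ger0_norm (W0 _)) ler_wpM2l.
    - exact: cvg_cst.
    - by rewrite -[X in _ --> X](mul0r M); apply: cvgMl.
  have HE n : H n%:R =
    \int[mu]_y (G y * w y) - \int[mu]_(x in `]n%:R, +oo[) (G x * w x).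
    by rewrite Rintegral_lower_upper// subKr.
  have -> : (fun n => Phi 0 n%:R - Phi 0 (- n%:R)) = (fun n =>
      - (W n%:R * G n%:R) - (\int[mu]_y (G y * w y)
        - \int[mu]_(x in `]n%:R, +oo[) (G x * w x)) +
      W (- n%:R) * G (- n%:R) + H (- n%:R)).
    by apply/funext => n; rewrite /Phi -HE; ring.
  rewrite -[X in _ --> - X]subr0 -[X in _ --> X]addr0 -[X in _ --> X + _]addr0
    -[X in _ --> X + _ + _]add0r -{1}oppr0.
  apply: cvgD; last exact: Rintegral_lower_cvg0.
  apply: cvgD; last first.
    apply: (WG0 (fun n => - n%:R)); rewrite -oppr0 WE; apply: cvgN.
    exact: Rintegral_lower_cvg0.
  apply: cvgB; first by apply: cvgN; apply: (WG0 (fun n => n%:R));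
    exact: Rintegral_upper_cvg0.
  by apply: cvgB; [exact: cvg_cst|exact: Rintegral_upper_cvg0].
rewrite lerNl; apply: (ler_cvg_to lim (cvg_cst _)).
by near=> n; exact: bound0.
Unshelve. all: end_near.
Qed.

End Lebesgue.

(** * Antidiagonal lines *)

Section ReflectionTranslation.
Context {R : realType}.
Local Notation mu := (@lebesgue_measure R).
Implicit Types (f : R -> R) (x y : R).

Lemma measurable_reflect s :
  measurable_fun setT ((fun u => s - u) : measurableTypeR R -> measurableTypeR R).
Proof. by apply: measurable_funB => //; exact: measurable_cst. Qed.

(** By uniqueness of Lebesgue measure, half-open intervals suffice; reflection swaps the closed
    endpoint but keeps the length. *)
Lemma lebesgue_measure_reflect s (A : set (measurableTypeR R)) : measurable A ->
  pushforward mu ((fun u => s - u) : measurableTypeR R -> measurableTypeR R) A =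
    mu A.
Proof.
move=> mA.
pose nu := measure_function_pushforward__canonical__measure_function_Measure mu
  (measurable_reflect s).
apply/esym/(@lebesgue_measure_unique R nu) => //= _ [[a b]] _ <-.
rewrite /pushforward.
have -> : (fun u : measurableTypeR R => s - u) @^-1` `]a, b] =
  [set` `[s - b, s - a[].
  apply/seteqP; split => x /=; rewrite !in_itv/= => /andP[xa xb]; apply/andP;
    split; lra.
rewrite !lebesgue_measure_itv/= !lte_fin ltrD2l ltrN2; case: ifP => // _.
by rewrite -!EFinD; congr EFin; ring.
Qed.

Lemma ge0_integral_reflect s (f : R -> \bar R) (A : set (measurableTypeR R)) :
  measurable A -> measurable_fun setT f -> (forall x, (0 <= f x)%E) ->
  (\int[mu]_(x in A) f x =
   \int[mu]_(x in (fun u => (s - u)%R) @^-1` A) f (s - x)%R)%E.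
Proof.
move=> mA mf f0.
rewrite -[RHS](@ge0_integral_pushforward _ _ _ _ _ _ (measurable_reflect s) mu A
  f)//; last exact: measurable_funS mf.
apply: eq_measure_integral => //= [|_ B mB BA]; first exact: measurable_reflect.
exact: esym (lebesgue_measure_reflect s mB).
Qed.

(** A translation is the composite of two reflections. *)
Lemma ge0_integral_translate s (f : R -> \bar R) :
  measurable_fun setT f -> (forall x, (0 <= f x)%E) ->
  (\int[mu]_x f (x - s)%R = \int[mu]_x f x)%E.
Proof.
move=> mf f0.
have mfN : measurable_fun setT (fun x => f (- x)).
  by apply: (measurableT_comp mf); exact: oppr_measurable.
transitivity (\int[mu]_x f (- x)%R)%E.
  rewrite [RHS](@ge0_integral_reflect s)// preimage_setT.
  by apply: eq_integral => x _; rewrite opprB.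
rewrite [RHS](@ge0_integral_reflect 0)// preimage_setT.
by apply: eq_integral => x _; rewrite sub0r.
Qed.

Lemma ge0_Rintegral_reflect s f (A : set (measurableTypeR R)) :
  measurable A -> measurable_fun setT f -> (forall x, 0 <= f x) ->
  \int[mu]_(x in A) f x =
  \int[mu]_(x in (fun u => s - u) @^-1` A) f (s - x).
Proof.
move=> mA mf f0; rewrite /Rintegral (@ge0_integral_reflect s)//.
exact/measurable_EFinP.
Qed.

(** The shear [(y, s) -> (s - y, y)] preserves the mass, since for fixed y it translates the first
    argument (Tonelli); Fubini then yields almost every line. *)
Lemma ae_integrable_antidiagonal (h : R -> R -> R) :
  measurable_fun [set: measurableTypeR R * measurableTypeR R]
    (fun z => h z.1 z.2) ->
  (forall x y, 0 <= h x y) ->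
  (\int[(mu \x mu)%E]_z (h z.1 z.2)%:E < +oo)%E ->
  {ae mu, forall s, mu.-integrable setT (fun y => (h (s - y) y)%:E)}.
Proof.
move=> mh h0 hfin.
pose g (z : measurableTypeR R * measurableTypeR R) := (h (z.2 - z.1) z.1)%:E.
have mg : measurable_fun setT g.
  apply/measurable_EFinP.
  have mp : measurable_fun setT (fun z : measurableTypeR R * measurableTypeR R =>
      (z.2 - z.1, z.1) : measurableTypeR R * measurableTypeR R).
    apply: measurable_fun_pair; last exact: measurable_fst.
    by apply: measurable_funB; [exact: measurable_snd|exact: measurable_fst].
  exact: (measurableT_comp mh mp).
have ig : (mu \x mu)%E.-integrable setT g.
  apply/integrable12ltyP => //.
  apply: le_lt_trans hfin.
  have mhE : measurable_fun [set: measurableTypeR R * measurableTypeR R]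
      (fun z => (h z.1 z.2)%:E) by exact/measurable_EFinP.
  have hE0 (z : measurableTypeR R * measurableTypeR R) : (0 <= (h z.1 z.2)%:E)%E.
    by rewrite lee_fin.
  rewrite (@fubini_tonelli2 _ _ _ _ _ mu mu _ mhE hE0).
  apply: ge0_le_integral => //.
  - by move=> x _; exact: integral_ge0.
  - have mag : measurable_fun setT (abse \o g) by exact: measurableT_comp.
    exact: (measurable_fun_fubini_tonelli_F (m2 := mu) _ mag (fun z => abse_ge0 _)).
  - exact: (measurable_fun_fubini_tonelli_G (m1 := mu) _ mhE hE0).
  move=> y _; rewrite /g /=.
  under eq_integral do rewrite ger0_norm//.
  rewrite (@ge0_integral_translate y (fun x => (h x y)%:E))//.
  - by apply/measurable_EFinP; exact: (measurable_fun_pair1 y mh).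
  - by move=> x; rewrite lee_fin.
exact: (ae_integrable2 ig).
Qed.

(** A null set contains no nonempty open interval. This extracts a concrete point from an
    almost-everywhere statement. *)
Lemma ae_exists_itv (P : R -> Prop) (a b : R) : a < b ->
  {ae mu, forall s, P s} -> exists2 s, s \in `]a, b[ & P s.
Proof.
move=> ab [Z [mZ Z0 PZ]].
apply: contrapT => nP.
have sub : `]a, b[ `<=` Z.
  by move=> s sab; apply: PZ => Ps; apply: nP; exists s.
have : (mu `]a, b[ <= mu Z)%E by apply: le_measure; rewrite ?inE//;
  exact: measurable_itv.
rewrite Z0 lebesgue_measure_itv/= lte_fin ab -EFinD lee_fin subr_le0.
by rewrite leNgt ab.
Qed.

End ReflectionTranslation.

(** * Derivatives of dominated parametric integrals *)

Section UnderIntegral.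
Context {R : realType}.
Local Notation mu := (@lebesgue_measure R).
Implicit Types (F : R -> R -> R) (a e x y s t : R) (B : R -> R).

Lemma itv_center a e : 0 < e -> a \in `]a - e, a + e[.
Proof. by move=> e0; rewrite in_itv/= ltrBlDr ltrDl e0. Qed.

Lemma derive1_bound_lipschitz (f : R -> R) (a b c : R) :
  (forall x, x \in `]a, b[ -> derivable f x 1) ->
  (forall x, x \in `]a, b[ -> `|derive1 f x| <= c) ->
  forall x y, x \in `]a, b[ -> y \in `]a, b[ -> `|f y - f x| <= c * `|y - x|.
Proof.
move=> df fc.
suff key x y : x \in `]a, b[ -> y \in `]a, b[ -> x <= y -> `|f y - f x| <=
  c * `|y - x|.
  move=> x y xab yab; have [xy|/ltW yx] := leP x y; first exact: key.
  by rewrite distrC (distrC y); exact: key.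
move=> xab yab xy.
have sub : `[x, y] `<=` `]a, b[.
  by apply: subset_itvSoo; rewrite bnd_simp;
    [rewrite (itvP xab)|rewrite (itvP yab)].
have [z zxy ->] : exists2 z, z \in `[x, y] & f y - f x = derive1 f z * (y - x).
  apply: MVT_segment => //.
    move=> z zxy; have zab : z \in `]a, b[ by apply: sub;
      exact: subset_itv_oo_cc zxy.
    by rewrite derive1E; apply: DeriveDef => //; exact: df.
  apply: continuous_subspaceW sub _.
  by apply: derivable_within_continuous => z; exact: df.
by rewrite normrM ler_wpM2r// fc//; exact: sub.
Qed.

(** The derivative is a pointwise limit of measurable difference quotients along a sequence. *)
Lemma measurable_derive1_param F a e : 0 < e ->
  (forall s, s \in `]a - e, a + e[ -> measurable_fun setT (F s)) ->
  (forall y, derivable (F^~ y) a 1) ->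
  measurable_fun setT (fun y => derive1 (F^~ y) a).
Proof.
move=> e0 mF dF.
(* The offset 2 gives [u n < e], so every [u n + a] stays in the open interval. *)
pose u n : R := e / n.+2%:R.
have u0 n : u n != 0 by rewrite mulf_neq0 ?gt_eqF// invr_gt0.
have cu : u n @[n --> \oo] --> 0.
  rewrite -[X in _ --> X](mulr0 e); apply: cvgMr.
  by have := @cvg_harmonic R; rewrite -cvg_shiftS.
have uI n : u n + a \in `]a - e, a + e[.
  have u1 : 0 < u n by rewrite divr_gt0.
  have u2 : u n < e by rewrite ltr_pdivrMr// ltr_pMr// ltr1n.
  rewrite in_itv/=; apply/andP; split; lra.
apply: (@measurable_fun_cvg _ _ _ _
  (fun n y => (u n)^-1 *: (F (u n + a) y - F a y))).
- move=> n; apply: measurable_funM => //; apply: measurable_funB; apply: mF => //.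
  exact: itv_center.
- move=> y _; have /cvg_ex[/= l fl] := dF y.
  have -> : derive1 (F^~ y) a = l.
    by apply/cvg_lim => //; move: fl; under eq_fun do rewrite scaler1.
  move: fl => /cvgr_dnbhsP/(_ u (conj u0 cu)).
  by under eq_fun do rewrite scaler1.
Qed.

Section Dominated.
Context (F : R -> R -> R) (a e s1 : R) (B : R -> R).
Local Notation I := `]a - e, a + e[.
Hypothesis e0 : 0 < e.
Hypothesis mF : forall s, s \in I -> measurable_fun setT (F s).
Hypothesis dF : forall s y, s \in I -> derivable (F^~ y) s 1.
Hypothesis iB : mu.-integrable setT (EFin \o B).
Hypothesis FB : forall s y, s \in I -> `|derive1 (F^~ y) s| <= B y.

Lemma param_lipschitz s t y : s \in I -> t \in I ->
  `|F t y - F s y| <= B y * `|t - s|.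
Proof.
move=> sI tI.
by apply: (@derive1_bound_lipschitz (F^~ y) (a - e) (a + e)) => // x xI;
  [exact: dF|exact: FB].
Qed.

(** The Lipschitz bound in the parameter, with integrable constant [B y], spreads integrability from
    [s1] to the whole interval. *)
Lemma param_integrable s : s1 \in I -> mu.-integrable setT (EFin \o F s1) ->
  s \in I -> mu.-integrable setT (EFin \o F s).
Proof.
move=> s1I i1 sI.
have iBs : mu.-integrable setT (EFin \o (fun y => B y * `|s - s1|)).
  exact: (integrableZr measurableT `|s - s1| iB).
have iD : mu.-integrable setT (EFin \o (fun y => `|F s1 y| + B y * `|s - s1|)).
  exact: (integrableD measurableT (integrable_norm i1) iBs).
apply: le_integrable iD => //; first by apply/measurable_EFinP; exact: mF.
move=> y _ /=; rewrite lee_fin; apply: le_trans (ler_norm _).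
rewrite -lerBlDl; apply: le_trans (lerB_dist _ _) _.
exact: param_lipschitz.
Qed.

Lemma param_integrable_derive1 :
  mu.-integrable setT (EFin \o (fun y => derive1 (F^~ y) a)).
Proof.
apply: le_integrable iB => //.
- apply/measurable_EFinP; apply: (measurable_derive1_param e0 mF).
  by move=> y; apply: dF; exact: itv_center.
- move=> y _ /=; rewrite lee_fin.
  by apply: le_trans (FB y (itv_center a e0)) (ler_norm _).
Qed.

Lemma param_is_derive (A : set (measurableTypeR R)) : measurable A ->
  s1 \in I -> mu.-integrable setT (EFin \o F s1) ->
  is_derive a 1 (fun s => \int[mu]_(y in A) F s y)
    (\int[mu]_(y in A) derive1 (F^~ y) a).
Proof.
move=> mA s1I i1.
have aI := itv_center a e0.
have B0 y : 0 <= B y by apply: le_trans (FB y aI).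
have iA f : mu.-integrable setT (EFin \o f) -> mu.-integrable A (EFin \o f).
  by apply: integrableS.
have H1 s : `]a - e, a + e[%classic s -> mu.-integrable A (EFin \o F s).
  by move=> sI; apply: iA; exact: param_integrable.
have H2 s y : `]a - e, a + e[%classic s -> A y -> derivable (F^~ y) s 1.
  by move=> sI _; exact: dF.
have H3 s y : `]a - e, a + e[%classic s -> A y -> `|partial1of2 F s y| <= B y.
  by move=> sI _; exact: FB.
apply: DeriveDef.
  exact: (derivable_under_integral mA aI H1 H2 B0 (iA _ iB) H3).
rewrite -derive1E.
exact: (differentiation_under_integral mA aI H1 H2 B0 (iA _ iB) H3).
Qed.

End Dominated.
End UnderIntegral.

(** * Derivatives in one variable, continuity and positivity *)

Section Derivatives.
Context {R : realType}.
Local Notation mu := (@lebesgue_measure R).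

Lemma derivable_is_derive1 (f : R -> R) (s : R) :
  derivable f s 1 -> is_derive s 1 f (derive1 f s).
Proof. by move=> df; rewrite derive1E; exact: DeriveDef. Qed.

Lemma is_derive_translate (g : R -> R) (c s : R) : derivable g (s - c) 1 ->
  is_derive s 1 (fun t => g (t - c)) (derive1 g (s - c)).
Proof.
move=> dg.
have dg' : is_derive (s - c) 1 g (derive1 g (s - c)).
  exact: derivable_is_derive1.
have dc : is_derive s 1 (fun t => t - c) 1.
  by rewrite -[X in is_derive _ _ _ X]subr0; apply: is_deriveB.
have := @is_derive1_comp R g (fun t => t - c) s _ _ dg' dc.
by rewrite mulr1.
Qed.

Lemma is_derive_reflect (g : R -> R) (s x : R) : derivable g (s - x) 1 ->
  is_derive x 1 (fun u => g (s - u)) (- derive1 g (s - x)).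
Proof.
move=> /derivable_is_derive1 dg.
have dc : is_derive x 1 (fun u => s - u) (- 1).
  by rewrite -[X in is_derive _ _ _ X]sub0r; apply: is_deriveB.
have := @is_derive1_comp R g (fun u => s - u) x _ _ dg dc.
by rewrite mulrN1.
Qed.

(** Turns the bounds on the partial derivatives of [phi h], weighted by [h], into bounds on those of
    [h]. *)
Lemma derive1_opp_ln (f : R -> R) (x : R) : 0 < f x -> derivable f x 1 ->
  derive1 (fun u => - ln (f u)) x * f x = - derive1 f x.
Proof.
move=> fx df.
have df' := derivable_is_derive1 df.
have dl := @is_derive1_comp R (@ln R) f x _ _ (is_derive1_ln fx) df'.
have dN := is_deriveN dl.
have -> : derive1 (fun u => - ln (f u)) x = - ((f x)^-1 * derive1 f x).
  by rewrite derive1E; exact: derive_val.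
by rewrite mulNr mulrAC mulVf ?mul1r// gt_eqF.
Qed.

Lemma is_derive_div (f g : R -> R) (s f' g' : R) :
  is_derive s 1 f f' -> is_derive s 1 g g' -> g s != 0 ->
  is_derive s 1 (fun t => f t / g t) (f' / g s - f s * g' / g s ^+ 2).
Proof.
move=> df dg gs.
have dv := is_deriveV gs dg.
have := is_deriveM df dv; rewrite /GRing.scale/=.
by congr (is_derive _ _ _ _); ring.
Qed.

Lemma is_derive_right (f : R -> R) (s l : R) : is_derive s 1 f l ->
  t^-1 * (f (s + t) - f s) @[t --> 0^'+] --> l.
Proof.
move=> [df fl]; apply: cvg_dnbhs_at_right.
have /cvg_ex[/= l' fl'] := df.
have -> : l = l' by rewrite -fl; apply/cvg_lim.
by move: fl'; under eq_fun do rewrite scaler1 (addrC _ s).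
Qed.

Lemma is_derive_ge0 (f : R -> R) (s l : R) : is_derive s 1 f l ->
  (\forall t \near 0^'+, f s <= f (s + t)) -> 0 <= l.
Proof.
move=> /is_derive_right fl fs.
apply: (ler_cvg_to (cvg_cst 0) fl); near=> t.
by rewrite mulr_ge0// ?invr_ge0 ?subr_ge0; [exact: ltW|near: t].
Unshelve. all: by end_near.
Qed.

Lemma cvg_right_translate (f : R -> R) (s : R) : {for s, continuous f} ->
  f (s + t) @[t --> 0^'+] --> f s.
Proof.
move=> cf; apply: cvg_at_right_filter.
have cs : (fun t : R => s + t) @ (0 : R) --> s + 0.
  by apply: cvgD; [exact: cvg_cst|exact: cvg_id].
by rewrite addr0 in cs; exact: (cvg_comp _ _ cs cf).
Qed.

Lemma absolutely_continuous_continuous (f : R -> R) :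
  absolutely_continuous f -> continuous f.
Proof.
move=> acf x; apply/cvgrPdist_lt => e e0.
have x1 : x - 1 <= x + 1 by lra.
have [d d0 dP] := acf _ _ x1 e e0.
have key (u v : R) :
  x - 1 <= u -> u <= v -> v <= x + 1 -> v - u < d -> `|f v - f u| < e.
  move=> xu uv vx uvd.
  (* A family of one interval gives uniform continuity on [[x - 1, x + 1]]. *)
  have := dP 1%N (fun=> u) (fun=> v) _ _ _.
  rewrite !big_ord1; apply => //.
  by move=> i j; rewrite !ord1 eqxx.
near=> z.
have : `|x - z| < Num.min 1 d.
  by near: z; apply: (@cvgr_dist_lt _ _ _ _ _ id) => //; rewrite lt_min d0 ltr01.
rewrite lt_min => /andP[zx1 zxd].
have /andP[z1 z2] : - 1 < x - z < 1 by rewrite -ltr_norml.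
have /andP[z3 z4] : - d < x - z < d by rewrite -ltr_norml.
have [xz|/ltW zx] := leP x z.
  by rewrite distrC; apply: key => //; clear -z1 z4 z2 z3 xz; lra.
by apply: key => //; clear -z1 z4 z2 z3 zx; lra.
Unshelve. all: by end_near.
Qed.

(** A zero integral would force [f] to vanish almost everywhere, hence at some point of []0, 1[]. *)
Lemma Rintegral_gt0 (f : R -> R) : mu.-integrable setT (EFin \o f) ->
  (forall x, 0 < f x) -> 0 < \int[mu]_x f x.
Proof.
move=> fi f0; rewrite lt_neqAle Rintegral_ge0 ?andbT; last by move=> x _;
  exact: ltW.
apply/eqP => I0.
have mf : measurable_fun setT (EFin \o f) by exact: measurable_int fi.
have /ae_eq_integral_abs : (\int[mu]_x `|(EFin \o f) x|)%E = 0%E.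
  under eq_integral do rewrite /= ger0_norm ?ltW//.
  by rewrite -[LHS]fineK ?[fine _](esym I0)//; exact: integrable_fin_num.
move=> /(_ measurableT mf) ae0.
have [y _ /(_ I) /= [fy]] := @ae_exists_itv R _ 0 1 ltr01 ae0.
by have := f0 y; rewrite fy ltxx.
Qed.

End Derivatives.

(** * Conditional laws on the lines [x + y = s] *)

Section ConditionalDerivatives.
Context {R : realType} (h : R -> R -> R) (s0 eps : R) (B C : R -> R).
Local Notation mu := (@lebesgue_measure R).
Local Notation I := `]s0 - eps, s0 + eps[.
Context (eps_gt0 : 0 < eps)
  (mh : measurable_fun [set: measurableTypeR R * measurableTypeR R]
    (fun z => h z.1 z.2))
  (h_gt0 : forall x y : R, 0 < h x y)
  (hfin : (\int[(mu \x mu)%E]_z (h z.1 z.2)%:E < +oo)%E)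
  (h_diff : coordinatewise_differentiable h)
  (iB : mu.-integrable setT (EFin \o B))
  (iC : mu.-integrable setT (EFin \o C))
  (hB : forall s y, s \in I -> `|partial1 h (s - y) y| <= B y)
  (hC : forall s x, s \in I -> `|partial2 h x (s - x)| <= C x).

(* [N] is the density of [X + Y], and [df2] is the derivative of the conditional
   density [f2 h v] at [s0]. *)
Let N s := \int[mu]_v h (s - v) v.
Let N' := \int[mu]_v partial1 h (s0 - v) v.
Let df2 v := partial1 h (s0 - v) v / N s0 - h (s0 - v) v * (N' / N s0 ^+ 2).

Let s0I : s0 \in I := itv_center s0 eps_gt0.

Let line_derive (s y : R) :
  is_derive s 1 (fun t => h (t - y) y) (partial1 h (s - y) y).
Proof. exact: (@is_derive_translate _ (h^~ y) y s (h_diff _ _).1). Qed.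

Let line_derive2 (s x : R) :
  is_derive s 1 (fun t => h x (t - x)) (partial2 h x (s - x)).
Proof. exact: (@is_derive_translate _ (h x) x s (h_diff _ _).2). Qed.

Let line_derive1 (s y : R) :
  derive1 (fun t => h (t - y) y) s = partial1 h (s - y) y.
Proof. by rewrite derive1E; case: (line_derive s y). Qed.

Let line_derive1_2 (s x : R) :
  derive1 (fun t => h x (t - x)) s = partial2 h x (s - x).
Proof. by rewrite derive1E; case: (line_derive2 s x). Qed.

Lemma measurable_line (s : R) : measurable_fun setT (fun y : R => h (s - y) y).
Proof.
have mp : measurable_fun setT (fun y : measurableTypeR R =>
    (s - y, y) : measurableTypeR R * measurableTypeR R).
  by apply: measurable_fun_pair => //; exact: measurable_reflect.
exact: (measurableT_comp mh mp).
Qed.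

Lemma measurable_line2 (s : R) : measurable_fun setT (fun x : R => h x (s - x)).
Proof.
have mp : measurable_fun setT (fun y : measurableTypeR R =>
    (y, s - y) : measurableTypeR R * measurableTypeR R).
  by apply: measurable_fun_pair => //; exact: measurable_reflect.
exact: (measurableT_comp mh mp).
Qed.

Let line_bound (s y : R) : s \in I -> `|derive1 (fun t => h (t - y) y) s| <= B y.
Proof. by move=> sI; rewrite line_derive1; exact: hB. Qed.

Let line_bound2 (s x : R) : s \in I -> `|derive1 (fun t => h x (t - x)) s| <= C x.
Proof. by move=> sI; rewrite line_derive1_2; exact: hC. Qed.

(** Some [s1] in the interval has an integrable line, and domination by [B] transfers this to every
    [s] there. *)
Lemma integrable_line (s : R) : s \in I ->
  mu.-integrable setT (EFin \o (fun y : R => h (s - y) y)).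
Proof.
have /ae_exists_itv :
  {ae mu, forall s, mu.-integrable setT (fun y => (h (s - y) y)%:E)}.
  by apply: ae_integrable_antidiagonal => // x y; exact: ltW.
move=> /(_ (s0 - eps) (s0 + eps))[|s1 s1I i1]; first by rewrite ltrD2l gtrN.
apply: (@param_integrable R (fun s y : R => h (s - y) y) s0 eps s1 B) => //.
- by move=> t _; exact: measurable_line.
- by move=> t y _; case: (line_derive t y).
Qed.

Lemma integral_line2 (s : R) (A : set (measurableTypeR R)) : measurable A ->
  \int[mu]_(x in A) h x (s - x) =
  \int[mu]_(y in (fun u => s - u) @^-1` A) h (s - y) y.
Proof.
move=> mA; rewrite (@ge0_Rintegral_reflect R s)//.
- by apply: eq_Rintegral => y _; rewrite subKr.
- exact: measurable_line2.
- by move=> x; exact: ltW.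
Qed.

Lemma integrable_line2 (s : R) : s \in I ->
  mu.-integrable setT (EFin \o (fun x : R => h x (s - x))).
Proof.
move=> sI; apply/integrableP; split.
  by apply/measurable_EFinP; exact: measurable_line2.
rewrite (@ge0_integral_reflect R s)//; last first.
  by apply: measurableT_comp => //; apply/measurable_EFinP; exact: measurable_line2.
rewrite preimage_setT.
have /integrableP[_] := integrable_line sI.
by apply: le_lt_trans; rewrite le_eqVlt; apply/orP; left; apply/eqP;
  apply: eq_integral => y _ /=; rewrite subKr.
Qed.

Lemma marginal_gt0 (s : R) : s \in I -> 0 < N s.
Proof. by move=> sI; apply: Rintegral_gt0; [exact: integrable_line|]. Qed.

Let Ns0 : N s0 != 0. Proof. by rewrite gt_eqF// marginal_gt0. Qed.

Lemma is_derive_line_integral (A : set (measurableTypeR R)) : measurable A ->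
  is_derive s0 1 (fun s => \int[mu]_(v in A) h (s - v) v)
    (\int[mu]_(v in A) partial1 h (s0 - v) v).
Proof.
move=> mA.
have -> : \int[mu]_(v in A) partial1 h (s0 - v) v =
    \int[mu]_(v in A) derive1 (fun t => h (t - v) v) s0.
  by apply: eq_Rintegral => v _; rewrite line_derive1.
apply: (@param_is_derive R (fun s v : R => h (s - v) v) s0 eps s0 B) => //.
- by move=> t _; exact: measurable_line.
- by move=> t y _; case: (line_derive t y).
- exact: integrable_line.
Qed.

(** With x fixed, s enters through the second argument of [h], so the dominating function is [C]. It
    serves the survival function of X, whose half-line stays fixed in this parametrization. *)
Lemma derivable_line2_integral (A : set (measurableTypeR R)) : measurable A ->
  derivable (fun s => \int[mu]_(x in A) h x (s - x)) s0 1.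
Proof.
move=> mA.
suff [] : is_derive s0 1 (fun s => \int[mu]_(x in A) h x (s - x))
    (\int[mu]_(x in A) derive1 (fun t => h x (t - x)) s0) by [].
apply: (@param_is_derive R (fun s x : R => h x (s - x)) s0 eps s0 C) => //.
- by move=> t _; exact: measurable_line2.
- by move=> t y _; case: (line_derive2 t y).
- exact: integrable_line2.
Qed.

Lemma near_center : \forall s \near s0, s \in I.
Proof. exact: near_in_itvoo. Qed.

Lemma integrable_partial1_line :
  mu.-integrable setT (EFin \o (fun v => partial1 h (s0 - v) v)).
Proof.
have : mu.-integrable setT (EFin \o (fun v => derive1 (fun t => h (t - v) v) s0)).
  apply: (@param_integrable_derive1 R (fun s v : R => h (s - v) v) s0 eps B) => //.
  - by move=> t _; exact: measurable_line.
  - by move=> t y _; case: (line_derive t y).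
by congr (mu.-integrable _ _); apply/funext => v /=; rewrite line_derive1.
Qed.

Lemma integrable_df2 : mu.-integrable setT (EFin \o df2).
Proof.
exact: (integrableB measurableT
  (integrableZr measurableT (N s0)^-1 integrable_partial1_line)
  (integrableZr measurableT (N' / N s0 ^+ 2) (integrable_line s0I))).
Qed.

(** The right side is the quotient-rule derivative at [s0] of the conditional probability that Y
    lies in [A]. *)
Lemma integral_df2E (A : set (measurableTypeR R)) : measurable A ->
  \int[mu]_(v in A) df2 v = (\int[mu]_(v in A) partial1 h (s0 - v) v) / N s0
    - (\int[mu]_(v in A) h (s0 - v) v) * N' / N s0 ^+ 2.
Proof.
move=> mA; rewrite RintegralB//; first 1 last.
- apply: integrableS measurableT mA _ _ => //.
  exact: (integrableZr measurableT (N s0)^-1 integrable_partial1_line).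
- apply: integrableS measurableT mA _ _ => //.
  exact: (integrableZr measurableT (N' / N s0 ^+ 2) (integrable_line s0I)).
rewrite !RintegralZr//; first by rewrite mulrA.
- by apply: integrableS measurableT mA _ _ => //; exact: integrable_line.
- by apply: integrableS measurableT mA _ _ => //; exact: integrable_partial1_line.
Qed.

(** Conditional densities all have mass one; this is the zero-mass condition of the integration by
    parts. *)
Lemma integral_df2 : \int[mu]_v df2 v = 0.
Proof.
rewrite integral_df2E// -/(N s0) -/N'; field; exact: Ns0.
Qed.

Lemma S_YE (y s : R) :
  s \in I -> S_Y h y s = (\int[mu]_(v in `]y, +oo[) h (s - v) v) / N s.
Proof.
move=> sI; rewrite /S_Y /f2 RintegralZr//.
by apply: integrable_setTS => //; exact: integrable_line.
Qed.

Lemma S_XE (x s : R) :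
  s \in I -> S_X h x s = (\int[mu]_(v in `]x, +oo[) h v (s - v)) / N s.
Proof.
move=> sI; rewrite /S_X /f1 RintegralZr//.
  by congr (_ / _); rewrite integral_line2// preimage_setT.
by apply: integrable_setTS => //; exact: integrable_line2.
Qed.

Lemma is_derive_S_Y (y : R) :
  is_derive s0 1 (S_Y h y) (\int[mu]_(v in `]y, +oo[) df2 v).
Proof.
rewrite integral_df2E//.
apply: (@near_eq_is_derive _ _ _
  (fun s => (\int[mu]_(v in `]y, +oo[) h (s - v) v) / N s)).
  near=> s; rewrite S_YE//; near: s; exact: near_center.
apply: is_derive_div => //; first exact: is_derive_line_integral.
exact: is_derive_line_integral.
Unshelve. all: by end_near.
Qed.

Lemma derivable_S_X (x : R) : derivable (S_X h x) s0 1.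
Proof.
apply: (@near_eq_derivable _ _ _
  (fun s => (\int[mu]_(v in `]x, +oo[) h v (s - v)) / N s)).
  near=> s; rewrite S_XE//; near: s; exact: near_center.
have dN : derivable N s0 1 by case: (is_derive_line_integral measurableT).
by apply: derivableM; [exact: derivable_line2_integral|exact: derivableV].
Unshelve. all: by end_near.
Qed.

Let near_right_I : \forall t \near 0^'+, s0 + t \in I.
Proof.
near=> t.
have te : t < eps by near: t; exact: nbhs_right_lt.
have t0 : 0 < t by [].
by rewrite in_itv/=; apply/andP; split; lra.
Unshelve. all: by end_near.
Qed.

(* Conditionally on [X + Y = s0 + t], the event [X > s0 - y] is [Y < y + t]. *)
Lemma survival_sum (y t : R) : 0 <= t -> s0 + t \in I ->
  S_X h (s0 - y) (s0 + t) + S_Y h y (s0 + t) =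
  1 + (\int[mu]_(v in `]y, y + t]) h (s0 + t - v) v) / N (s0 + t).
Proof.
move=> t0 sI; rewrite S_XE// S_YE// -mulrDl integral_line2//.
have il := integrable_line sI.
have -> : (fun u => s0 + t - u) @^-1` [set` `]s0 - y, +oo[] = [set` `]-oo, y + t[].
  by apply/seteqP; split => x /=; rewrite !in_itv/= ?andbT; lra.
rewrite Rintegral_itv_bndo_bndc; last by apply: integrable_setTS.
rewrite Rintegral_lower_upper// -Rintegral_lower_diff ?lerDl// -/(N (s0 + t)).
by field; rewrite gt_eqF// marginal_gt0.
Qed.

(* [h] need not be differentiable along the lines, so this cannot be obtained by
   integrating the derivative of the density; it comes from [survival_sum] and the
   Lebesgue differentiation theorem. *)
Lemma ae_survival_density : {ae mu, forall y,
  derive1 (S_X h (s0 - y)) s0 + derive1 (S_Y h y) s0 = h (s0 - y) y / N s0}.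
Proof.
have il := integrable_line s0I.
have il' y : mu.-integrable `]-oo, y] (EFin \o (fun v : R => h (s0 - v) v)).
  by apply: integrable_setTS il; exact: measurable_itv.
have ll : locally_integrable setT (fun v : R => h (s0 - v) v).
  apply: open_integrable_locally => //; exact: openT.
(* Outside a null set, the indefinite integral of [h] along the line has derivative
   [h (s0 - y) y]. *)
have [Z [mZ Z0 PZ]] := FTC1Ny il' ll.
exists Z; split => //; apply: subset_trans PZ; apply: subsetC => y [dF F'].
have cB := continuous_Rintegral_lower iB.
have nI : \forall t \near 0^'+, 0 < t /\ s0 + t \in I.
  by near=> t; split => //; near: t; exact: near_right_I.
pose Q (t : R) := \int[mu]_(v in `]y, y + t]) h (s0 - v) v.
pose Qs (t : R) := \int[mu]_(v in `]y, y + t]) h (s0 + t - v) v.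
have cQ : t^-1 * Q t @[t --> 0^'+] --> h (s0 - y) y.
  have dF' : is_derive y 1 (fun x => \int[mu]_(t in `]-oo, x]) h (s0 - t) t)
    (h (s0 - y) y).
    by rewrite -F' derive1E; exact: DeriveDef.
  apply: cvg_trans (is_derive_right dF'); apply: near_eq_cvg; near=> t.
  by rewrite Rintegral_lower_diff// lerDl ltW.
(* Moving the line from [s0] to [s0 + t] changes the integrand by at most [t * B v]; after division
   by [t] the error is the integral of [B] over []y, y + t]], which tends to 0. *)
have cQs : t^-1 * Qs t @[t --> 0^'+] --> h (s0 - y) y.
  have D0 : t^-1 * (Qs t - Q t) @[t --> 0^'+] --> 0.
    apply: norm_cvg0.
    apply: (@squeeze_cvgr _ _ _ _ (cst 0) (fun t =>
      \int[mu]_(v in `]-oo, y + t]) B v - \int[mu]_(v in `]-oo, y]) B v)).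
    - near=> t.
      have [t0 tI] : 0 < t /\ s0 + t \in I by near: t.
      have mi : measurable (`]y, y + t] : set (measurableTypeR R))
        by exact: measurable_itv.
      have ilt := integrable_line tI.
      have yt : y <= y + t by rewrite lerDl ltW.
      rewrite (Rintegral_lower_diff iB yt) normr_ge0/=.
      rewrite normrM ger0_norm ?invr_ge0
        ?(ltW t0)// ler_pdivrMl// -RintegralZl//; last exact: integrable_setTS.
      rewrite -RintegralB//; [|exact: integrable_setTS|exact: integrable_setTS].
      have iD : mu.-integrable setT
        (EFin \o (fun v => h (s0 + t - v) v - h (s0 - v) v)).
        exact: (integrableB measurableT ilt il).
      have iDA := integrable_setTS mi iD.
      apply: le_trans (le_normr_Rintegral mi iDA) _.
      apply: le_Rintegral => //.
      + exact: integrable_norm.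
      + apply: integrable_setTS => //; exact: (integrableZl measurableT t iB).
      + move=> v _; rewrite mulrC.
        have := @param_lipschitz R (fun s v : R => h (s - v) v) s0 eps B _ _ s0
          (s0 + t) v s0I tI.
        rewrite (_ : s0 + t - s0 = t); last by ring.
        rewrite (gtr0_norm t0); apply; last by move=> s x; exact: line_bound.
        by move=> s x _; case: (line_derive s x).
    - exact: cvg_cst.
    - rewrite -[X in _ --> X](subrr (\int[mu]_(v in `]-oo, y]) B v)).
      by apply: cvgB; [exact: (cvg_right_translate (cB y))|exact: cvg_cst].
  rewrite -[X in _ --> X]addr0.
  apply: cvg_trans (cvgD cQ D0); apply: near_eq_cvg; apply: nearW => t /=.
  rewrite -mulrDr; congr (_ * _); exact: (subrKC (Q t) (Qs t)).
have cN : N (s0 + t) @[t --> 0^'+] --> N s0.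
  apply: cvg_right_translate; apply/differentiable_continuous/derivable1_diffP.
  by case: (is_derive_line_integral measurableT).
have dS : is_derive s0 1 (fun s => S_X h (s0 - y) s + S_Y h y s)
    (derive1 (S_X h (s0 - y)) s0 + derive1 (S_Y h y) s0).
  apply: is_deriveD.
    by apply: derivable_is_derive1; exact: derivable_S_X.
  by apply: derivable_is_derive1; case: (is_derive_S_Y y).
have l1 := is_derive_right dS.
suff l2 : t^-1 * (S_X h (s0 - y) (s0 + t) + S_Y h y (s0 + t) -
    (S_X h (s0 - y) s0 + S_Y h y s0)) @[t --> 0^'+] --> h (s0 - y) y / N s0.
  exact: (cvg_unique _ l1 l2).
have l3 : t^-1 * Qs t / N (s0 + t) @[t --> 0^'+] --> h (s0 - y) y / N s0.
  by apply: cvgM => //; apply: cvgV.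
apply: cvg_trans l3; apply: near_eq_cvg; near=> t.
have [t0 tI] : 0 < t /\ s0 + t \in I by near: t.
(* This is the case [t = 0], where the interval is empty. *)
have E0 : S_X h (s0 - y) s0 + S_Y h y s0 = 1.
  have := @survival_sum y 0 (lexx _); rewrite !addr0 => ->//.
  by rewrite set_itvoc0 Rintegral_set0 mul0r addr0.
by rewrite E0 (@survival_sum y t (ltW t0) tI) [1 + _]addrC addrK mulrA.
Unshelve. all: by end_near.
Qed.


(** * The function [Psi] and the lower bound at [s0] *)

Context (Psi : R -> R -> R) (A : R -> R) (M : R)
  (Psi_nd : coordinatewise_nondecreasing Psi)
  (Psi_diff : coordinatewise_differentiable Psi)
  (Psi_cont : forall s : R, s \in I -> continuous (fun y : R => Psi (s - y) y))
  (Psi_bound : forall s y : R, s \in I -> `|Psi (s - y) y| <= M)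
  (iA : mu.-integrable setT (EFin \o A))
  (hA : forall s y : R, s \in I -> `|partial1 Psi (s - y) y * h (s - y) y| <= A y)
  (S_X_nd : forall x : R, {in I &, {homo S_X h x : s t / s <= t}})
  (S_Y_nd : forall y : R, {in I &, {homo S_Y h y : s t / s <= t}}).

Let G (y : R) := Psi (s0 - y) y.
Let q (y : R) := partial1 Psi (s0 - y) y.
Let p (y : R) := partial1 h (s0 - y) y.
Let K (y : R) := \int[mu]_(v in `]y, +oo[) df2 v.
Let theta := sup [set partial2 (S_Y h) (s0 - x) s0 /
                  (partial2 (S_X h) x s0 + partial2 (S_Y h) (s0 - x) s0)
             | x in [set: R]].

Let Psi_derive (s y : R) :
  is_derive s 1 (fun t => Psi (t - y) y) (partial1 Psi (s - y) y).
Proof. exact: (@is_derive_translate _ (Psi^~ y) y s (Psi_diff _ _).1). Qed.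

Let measurable_Psi (s : R) :
  s \in I -> measurable_fun setT (fun y : R => Psi (s - y) y).
Proof. by move=> sI; apply: continuous_measurable_fun; exact: Psi_cont. Qed.

Let K_derive (y : R) : K y = partial2 (S_Y h) y s0.
Proof. by rewrite /partial2 derive1E; case: (is_derive_S_Y y). Qed.

Let K_ge0 (y : R) : 0 <= K y.
Proof.
apply: (is_derive_ge0 (is_derive_S_Y y)); near=> t.
apply: S_Y_nd => //; last by rewrite lerDl ltW.
by near: t; exact: near_right_I.
Unshelve. all: by end_near.
Qed.

Let L_ge0 (x : R) : 0 <= partial2 (S_X h) x s0.
Proof.
rewrite /partial2; have dS := derivable_is_derive1 (@derivable_S_X x).
apply: (is_derive_ge0 dS); near=> t.
apply: S_X_nd => //; last by rewrite lerDl ltW.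
by near: t; exact: near_right_I.
Unshelve. all: by end_near.
Qed.

Let q_ge0 (y : R) : 0 <= q y.
Proof.
rewrite /q /partial1; have dP := derivable_is_derive1 (Psi_diff (s0 - y) y).1.
apply: (is_derive_ge0 dP); near=> t.
by apply: Psi_nd.1; rewrite lerDl ltW.
Unshelve. all: by end_near.
Qed.

Let ratio (x : R) := partial2 (S_Y h) (s0 - x) s0 /
  (partial2 (S_X h) x s0 + partial2 (S_Y h) (s0 - x) s0).

Let ratio_ge0 (x : R) : 0 <= ratio x.
Proof.
rewrite /ratio -K_derive; apply: divr_ge0; first exact: K_ge0.
by apply: addr_ge0; [exact: L_ge0|exact: K_ge0].
Qed.

Let ratio_le1 (x : R) : ratio x <= 1.
Proof.
rewrite /ratio -K_derive; have L0 := L_ge0 x; have := K_ge0 (s0 - x).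
(* A zero numerator makes the ratio 0 whatever the denominator. *)
rewrite le_eqVlt => /predU1P[<-|K0]; first by rewrite mul0r.
by rewrite ler_pdivrMr ?mul1r ?ltr_wpDl// lerDr.
Qed.

(** The bound by 1 ensures that [sup] is an upper bound and not a default value. *)
Let ratio_theta (x : R) : ratio x <= theta.
Proof.
apply: ub_le_sup; first by exists 1 => _ [z _ <-]; exact: ratio_le1.
by exists x.
Qed.

Let theta_ge0 : 0 <= theta.
Proof. exact: le_trans (ratio_ge0 0) (ratio_theta 0). Qed.

(** Multiply out the ratio at [x = s0 - y]; the case [K y = 0] is separate because the denominator
    may vanish there. *)
Let K_le (y : R) : K y <= theta * (partial2 (S_X h) (s0 - y) s0 + K y).
Proof.
have L0 := L_ge0 (s0 - y).
have := K_ge0 y; rewrite le_eqVlt => /predU1P[<-|K0].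
  by rewrite addr0 mulr_ge0.
rewrite -ler_pdivrMr; last by rewrite ltr_wpDl.
by have := ratio_theta (s0 - y); rewrite /ratio subKr -K_derive.
Qed.

Let K_density : {ae mu, forall y, K y <= theta * (h (s0 - y) y / N s0)}.
Proof.
have := ae_survival_density; apply: filterS;
  first exact: (ae_filter_ringOfSetsType mu).
by move=> y E; rewrite -E; have := K_le y; rewrite K_derive.
Qed.

Let measurable_q : measurable_fun setT q.
Proof.
have -> : q = (fun y => derive1 (fun t => Psi (t - y) y) s0).
  by apply/funext => y; rewrite derive1E; case: (Psi_derive s0 y).
apply: (@measurable_derive1_param R (fun t y => Psi (t - y) y) s0 eps) => //.
by move=> y; case: (Psi_derive s0 y).
Qed.

Let integrable_qh : mu.-integrable setT (EFin \o (fun y => q y * h (s0 - y) y)).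
Proof.
apply: le_integrable iA => //.
  by apply/measurable_EFinP; apply: measurable_funM => //; exact: measurable_line.
move=> y _ /=; rewrite lee_fin; apply: le_trans (ler_norm _); exact: hA.
Qed.

Let integrable_qf2 :
  mu.-integrable setT (EFin \o (fun y => q y * (h (s0 - y) y / N s0))).
Proof.
have := integrableZr measurableT (N s0)^-1 integrable_qh.
by congr (mu.-integrable _ _); apply/funext => y /=; rewrite -EFinM mulrA.
Qed.

Let measurable_K : measurable_fun setT K.
Proof.
have -> : K = (fun y => \int[mu]_v df2 v - \int[mu]_(v in `]-oo, y]) df2 v).
  by apply/funext => y; rewrite /K Rintegral_lower_upper//; exact: integrable_df2.
apply: continuous_measurable_fun => y; apply: cvgB; first exact: cvg_cst.
exact: continuous_Rintegral_lower integrable_df2 _.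
Qed.

Let f2_ge0 (y : R) : 0 <= h (s0 - y) y / N s0.
Proof. by apply: divr_ge0; apply: ltW => //; exact: marginal_gt0. Qed.

(** Stated in extended reals because integrability of [q K] is deduced from this very comparison. *)
Let integral_qK : (\int[mu]_y (q y * K y)%:E <=
  \int[mu]_y (theta * (q y * (h (s0 - y) y / N s0)))%:E)%E.
Proof.
apply: ae_ge0_le_integral.
- exact: measurableT.
- by move=> y _; rewrite lee_fin mulr_ge0.
- by apply/measurable_EFinP; exact: measurable_funM.
- by move=> y _; rewrite lee_fin; apply: mulr_ge0 => //; apply: mulr_ge0.
- exact: measurable_int (integrableZl measurableT theta integrable_qf2).
- have := K_density; apply: filterS; first exact: (ae_filter_ringOfSetsType mu).
  move=> y Ky _; rewrite lee_fin mulrCA; exact: ler_wpM2l.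
Qed.

Let integrable_qK : mu.-integrable setT (EFin \o (fun y => q y * K y)).
Proof.
apply/integrableP; split; first by apply/measurable_EFinP; exact: measurable_funM.
under eq_integral do rewrite /= ger0_norm ?mulr_ge0//.
apply: le_lt_trans integral_qK _.
have iq := integrableZl measurableT theta integrable_qf2.
exact: (integrable_lty measurableT iq).
Qed.

Let Rintegral_qK : \int[mu]_y (q y * K y) <=
  theta * \int[mu]_y (q y * (h (s0 - y) y / N s0)).
Proof.
rewrite -RintegralZl//; apply: fine_le; last exact: integral_qK.
- exact: integrable_fin_num.
- have iq := integrableZl measurableT theta integrable_qf2.
  exact: (integrable_fin_num measurableT iq).
Qed.

Let G_bound (y : R) : `|G y| <= M. Proof. exact: Psi_bound. Qed.

Let G_cont : continuous G. Proof. exact: Psi_cont. Qed.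

(* Monotonicity of [Psi] in its second argument replaces a chain rule along the
   line, which coordinatewise differentiability does not provide. *)
Let G_dini (y e : R) : 0 < e ->
  \forall t \near 0^'+, - ((q y + e) * t) <= G (y + t) - G y.
Proof.
move=> e0.
have d := is_derive_right (@is_derive_reflect _ (Psi^~ y) s0 y (Psi_diff _ _).1).
near=> t.
have t0 : 0 < t by [].
have : - q y - e <= t^-1 * (Psi (s0 - (y + t)) y - Psi (s0 - y) y).
  near: t; apply: (cvgr_ge _ d).
  by rewrite ltrBlDr ltrDl.
rewrite mulrC ler_pdivlMr// -opprD mulNr => /le_trans; apply.
by apply: lerB => //; apply: Psi_nd.2; rewrite lerDl ltW.
Unshelve. all: by end_near.
Qed.

Let integral_Gdf2 : - (theta * \int[mu]_y (q y * (h (s0 - y) y / N s0))) <=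
  \int[mu]_y (G y * df2 y).
Proof.
apply: (@le_trans _ _ (- \int[mu]_y (q y * K y))); first by rewrite lerN2.
by apply: Rintegral_by_parts_ge;
  [exact: G_cont|exact: G_bound|exact: integrable_df2|
  exact: integral_df2|exact: K_ge0|exact: q_ge0|exact: integrable_qK|exact: G_dini].
Qed.

Let J (s : R) := \int[mu]_y (Psi (s - y) y * h (s - y) y).

Let integrable_Gh (s : R) : s \in I ->
  mu.-integrable setT (EFin \o (fun y => Psi (s - y) y * h (s - y) y)).
Proof.
move=> sI; apply: (@integrable_bounded_mul R (fun y => Psi (s - y) y)
  (fun y => h (s - y) y) M).
- exact: measurable_Psi.
- by move=> y; exact: Psi_bound.
- exact: integrable_line.
Qed.

Let integrable_Gp : mu.-integrable setT (EFin \o (fun y => G y * p y)).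
Proof.
apply: integrable_bounded_mul G_bound _; first exact: measurable_Psi.
exact: integrable_partial1_line.
Qed.

Let cond_expectationE (s : R) : s \in I -> cond_expectation h Psi s = J s / N s.
Proof.
move=> sI; rewrite /cond_expectation /f2.
under eq_Rintegral do rewrite mulrA.
by rewrite RintegralZr//; exact: integrable_Gh.
Qed.

(** Product rule under the integral sign, dominated by [M * B + A]. *)
Let J_derive : is_derive s0 1 J
  (\int[mu]_y (G y * p y) + \int[mu]_y (q y * h (s0 - y) y)).
Proof.
have dline (s y : R) : is_derive s 1 (fun t => Psi (t - y) y * h (t - y) y)
    (Psi (s - y) y * partial1 h (s - y) y + h (s - y) y * partial1 Psi (s - y) y).
  exact: (is_deriveM (Psi_derive s y) (line_derive s y)).
have dline1 (s y : R) : derive1 (fun t => Psi (t - y) y * h (t - y) y) s =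
    Psi (s - y) y * partial1 h (s - y) y + partial1 Psi (s - y) y * h (s - y) y.
  by rewrite derive1E (mulrC (partial1 Psi _ _)); case: (dline s y).
have iAB : mu.-integrable setT (EFin \o (fun y => M * B y + A y)).
  exact: (integrableD measurableT (integrableZl measurableT M iB) iA).
rewrite -RintegralD//.
have -> : \int[mu]_y (G y * p y + q y * h (s0 - y) y) =
    \int[mu]_y derive1 (fun t => Psi (t - y) y * h (t - y) y) s0.
  by apply: eq_Rintegral => y _; rewrite dline1.
apply: (@param_is_derive R (fun s y : R => Psi (s - y) y * h (s - y) y) s0 eps s0
  (fun y => M * B y + A y) eps_gt0).
- by move=> s sI; apply: measurable_funM;
  [exact: measurable_Psi|exact: measurable_line].
- by move=> s y _; case: (dline s y).
- exact: iAB.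
- move=> s y sI; rewrite dline1; apply: le_trans (ler_normD _ _) _.
  apply: lerD; last exact: hA.
  by rewrite normrM; apply: ler_pM => //; [exact: Psi_bound|exact: hB].
- exact: measurableT.
- exact: s0I.
- exact: integrable_Gh.
Qed.

Let cond_expectation_derive : is_derive s0 1 (cond_expectation h Psi)
  (\int[mu]_y (q y * (h (s0 - y) y / N s0)) + \int[mu]_y (G y * df2 y)).
Proof.
have -> : \int[mu]_y (q y * (h (s0 - y) y / N s0)) =
  \int[mu]_y (q y * h (s0 - y) y) / N s0.
  by under eq_Rintegral do rewrite mulrA; rewrite RintegralZr.
(* These are the terms of the quotient rule in which [Psi] is not differentiated. *)
have -> : \int[mu]_y (G y * df2 y) =
  \int[mu]_y (G y * p y) / N s0 - J s0 * (N' / N s0 ^+ 2).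
  rewrite -RintegralZr// -RintegralZr ?integrable_Gh// -RintegralB//; last 2 first.
  - exact: (integrableZr measurableT (N s0)^-1 integrable_Gp).
  - exact: (integrableZr measurableT (N' / N s0 ^+ 2) (integrable_Gh s0I)).
  by apply: eq_Rintegral => y _; rewrite /df2 mulrBr !mulrA.
have dN : is_derive s0 1 N N' by exact: is_derive_line_integral.
have := is_derive_div J_derive dN Ns0.
rewrite (_ : _ / N s0 - _ = \int[mu]_y (q y * h (s0 - y) y) / N s0 +
   (\int[mu]_y (G y * p y) / N s0 - J s0 * (N' / N s0 ^+ 2))); last by ring.
apply: near_eq_is_derive; near=> s; rewrite cond_expectationE//.
by near: s; exact: near_center.
Unshelve. all: by end_near.
Qed.

Theorem cond_expectation_derivative_ge :
  derivable (cond_expectation h Psi) s0 1 /\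
  (1 - theta) * cond_expectation h (partial1 Psi) s0 <=
    derive1 (cond_expectation h Psi) s0.
Proof.
case: cond_expectation_derive => dE; rewrite derive1E => ->; split => //.
rewrite mulrBl mul1r lerD2l; exact: integral_Gdf2.
Qed.

End ConditionalDerivatives.

Theorem theorem4p1 (R : realType) (d : measure_display) (T : measurableType d)
    (P : probability T R) (X Y : {RV P >-> R}) (h Psi : R -> R -> R)
    (hXY : has_joint_density X Y h)
    (Psi_nd : coordinatewise_nondecreasing Psi)
    (hefron : efron_monotonicity h)
    (s0 eps : R) (eps_gt0 : 0 < eps)
    (h_gt0 : forall x y : R, 0 < h x y)
    (h_diff : coordinatewise_differentiable h)
    (Psi_diff : coordinatewise_differentiable Psi)
    (Psi_ac : forall s : R, s \in `[s0 - eps, s0 + eps] ->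
      absolutely_continuous (fun x => Psi x (s - x)))
    (phi_ac : forall s : R, s \in `[s0 - eps, s0 + eps] ->
      absolutely_continuous (fun x => partial1 (phi h) x (s - x)))
    (S_X_nd : forall x : R,
      {in `[s0 - eps, s0 + eps] &, {homo S_X h x : s t / s <= t}})
    (S_Y_nd : forall y : R,
      {in `[s0 - eps, s0 + eps] &, {homo S_Y h y : s t / s <= t}})
    (A B C D : R -> R) (M : R)
    (A_L1 : (@lebesgue_measure R).-integrable setT (EFin \o A))
    (B_L1 : (@lebesgue_measure R).-integrable setT (EFin \o B))
    (C_L1 : (@lebesgue_measure R).-integrable setT (EFin \o C))
    (D_L1 : (@lebesgue_measure R).-integrable setT (EFin \o D))
    (M_gt0 : 0 < M)
    (Psi_bound : forall s y : R, s \in `[s0 - eps, s0 + eps] ->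
      `|Psi (s - y) y| <= M)
    (dPsi_bound : forall s y : R, s \in `[s0 - eps, s0 + eps] ->
      `|partial1 Psi (s - y) y * h (s - y) y| <= A y)
    (dphi1_bound : forall s y : R, s \in `[s0 - eps, s0 + eps] ->
      `|partial1 (phi h) (s - y) y * h (s - y) y| <= B y)
    (dphi2_bound : forall s x : R, s \in `[s0 - eps, s0 + eps] ->
      `|partial2 (phi h) x (s - x) * expR (- phi h x (s - x))|
        <= Num.min (C x) (D (s - x))) :
  derivable (cond_expectation h Psi) s0 1 /\
  derive1 (cond_expectation h Psi) s0 >=
    (1 - sup [set partial2 (S_Y h) (s0 - x) s0 /
                  (partial2 (S_X h) x s0 + partial2 (S_Y h) (s0 - x) s0)
             | x in [set: R]])
    * cond_expectation h (partial1 Psi) s0.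
Proof.
have [mh h0 hP] := hXY.
have hfin : (\int[(@lebesgue_measure R \x @lebesgue_measure R)%E]_z
  (h z.1 z.2)%:E < +oo)%E.
  by rewrite -hP// preimage_setT probability_setT ltry.
have sub (s : R) : s \in `]s0 - eps, s0 + eps[ -> s \in `[s0 - eps, s0 + eps].
  exact: subset_itv_oo_cc.
have hB (s y : R) : s \in `]s0 - eps, s0 + eps[ -> `|partial1 h (s - y) y| <= B y.
  move=> /sub sI; have := dphi1_bound s y sI.
  rewrite [X in `|X|](@derive1_opp_ln R (h^~ y) (s - y) (h_gt0 _ _) (h_diff _ _).1).
  by rewrite normrN.
have hC (s x : R) : s \in `]s0 - eps, s0 + eps[ -> `|partial2 h x (s - x)| <= C x.
  move=> /sub sI; have := dphi2_bound s x sI.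
  rewrite /phi opprK lnK ?posrE//.
  rewrite [X in `|X|](@derive1_opp_ln R (h x) (s - x) (h_gt0 _ _) (h_diff _ _).2).
  by rewrite normrN le_min => /andP[].
(* Composing with the reflection [u -> s - u] passes from the parameter x to the parameter y on the
   line. *)
have Psi_cont (s : R) :
  s \in `]s0 - eps, s0 + eps[ -> continuous (fun y : R => Psi (s - y) y).
  move=> /sub sI y.
  have cf := absolutely_continuous_continuous (Psi_ac s sI).
  have cr : {for y, continuous (fun u : R => s - u)}.
    by apply: cvgB; [exact: cvg_cst|exact: cvg_id].
  have -> : (fun u : R => Psi (s - u) u) =
    (fun x => Psi x (s - x)) \o (fun u => s - u).
    by apply/funext => u /=; rewrite subKr.
  exact: continuous_comp cr (cf _).
apply: (@cond_expectation_derivative_ge R h s0 eps B C eps_gt0 mh h_gt0 hfin h_diff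
  B_L1 C_L1 hB hC Psi A M Psi_nd Psi_diff Psi_cont _ A_L1).
- by move=> s y /sub; exact: Psi_bound.
- by move=> s y /sub; exact: dPsi_bound.
- by move=> x s t /sub sI /sub tI; exact: S_X_nd.
- by move=> y s t /sub sI /sub tI; exact: S_Y_nd.
Qed.
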